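(* Let $\mathbf A=(A;w)$ be a finite algebra whose only basic operation $w$ is a weak near-unanimity operation, and let ${\sim}$ be an Abelian congruence of $\mathbf A$ with ${\sim}\prec 1_{\mathbf A}$ in $\mathrm{Con}\,\mathbf A$ and $\mathrm{typ}({\sim},1_{\mathbf A})=\mathbf 5$. Then, in the order $\le$ on $A/{\sim}$ described below, there exists a least ${\sim}$-class.
   Context: An $n$-ary operation $w$ is a weak near-unanimity operation if it is idempotent and satisfies $w(x,\dots,x,y)=w(x,\dots,x,y,x)=\dots=w(y,x,\dots,x)$. Types are those of tame congruence theory. Order on $A/{\sim}$: for every $({\sim},1_{\mathbf A})$-minimal set $U$ (whose body is all of $U$), $U$ meets exactly two ${\sim}$-classes $C_1,C_2$, and the polynomial operations of $\mathbf A$ restricted to $U$ induce a two-element semilattice on $\{C_1\cap U,C_2\cap U\}$ modulo ${\sim}$; declare $C_1$ below $C_2$ if $C_1\cap U$ is the bottom of this semilattice. $\le$ is the reflexive-transitive closure of these relations over all minimal sets; it is a connected partial order on $A/{\sim}$. *)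

(* Defs.v *)
(* An algebra with one basic operation is a finType [A] together
   with [w : {ffun 'I_n -> A} -> A].  Tame congruence theory notions follow
   Hobby and McKenzie, The Structure of Finite Algebras. *)
From mathcomp Require Import all_boot.
From Stdlib Require Export Relation_Operators.

Set Implicit Arguments.
Unset Strict Implicit.
Unset Printing Implicit Defensive.

Definition weak_near_unanimity (A : finType) (n : nat)
    (w : {ffun 'I_n -> A} -> A) : Prop :=
  (forall x, w [ffun=> x] = x) /\
  (forall (x y : A) (i j : 'I_n),
     w [ffun l => if l == i then y else x] =
     w [ffun l => if l == j then y else x]).

Inductive pterm (A : Type) (n k : nat) : Type :=
| PVar of 'I_k
| PCst of A
| POp of ('I_n -> pterm A n k).

Fixpoint peval (A : finType) (n k : nat) (w : {ffun 'I_n -> A} -> A)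
    (t : pterm A n k) (x : {ffun 'I_k -> A}) : A :=
  match t with
  | PVar i => x i
  | PCst a => a
  | POp s => w [ffun i => peval w (s i) x]
  end.

Definition polynomial_op (A : finType) (n k : nat) (w : {ffun 'I_n -> A} -> A)
    (f : {ffun 'I_k -> A} -> A) : Prop :=
  exists t : pterm A n k, forall x, f x = peval w t x.

Definition unary_polynomial (A : finType) (n : nat) (w : {ffun 'I_n -> A} -> A)
    (g : A -> A) : Prop :=
  polynomial_op w (fun x : {ffun 'I_1 -> A} => g (x ord0)).

Definition congruence (A : finType) (n : nat) (w : {ffun 'I_n -> A} -> A)
    (r : rel A) : Prop :=
  [/\ reflexive r, symmetric r, transitive r &
      forall x y : {ffun 'I_n -> A},
        (forall i, r (x i) (y i)) -> r (w x) (w y)].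

Definition con0 (A : finType) : rel A := fun x y => x == y.
Definition con1 (A : finType) : rel A := fun _ _ => true.

Definition con_covered (A : finType) (n : nat) (w : {ffun 'I_n -> A} -> A)
    (alpha beta : rel A) : Prop :=
  [/\ congruence w alpha, congruence w beta,
      subrel alpha beta, ~ subrel beta alpha &
      forall theta : rel A, congruence w theta ->
        subrel alpha theta -> subrel theta beta ->
        subrel theta alpha \/ subrel beta theta].

Definition fcons (A : finType) (m : nat) (u : A) (x : {ffun 'I_m -> A}) :
    {ffun 'I_m.+1 -> A} :=
  [ffun i => oapp x u (unlift ord0 i)].

(* The relation C(alpha, beta; gamma). *)
Definition centralizes (A : finType) (n : nat) (w : {ffun 'I_n -> A} -> A)
    (alpha beta gamma : rel A) : Prop :=
  forall (m : nat) (f : {ffun 'I_m.+1 -> A} -> A), polynomial_op w f ->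
  forall (u v : A) (x y : {ffun 'I_m -> A}),
    alpha u v -> (forall i, beta (x i) (y i)) ->
    (gamma (f (fcons u x)) (f (fcons u y)) <->
     gamma (f (fcons v x)) (f (fcons v y))).

Definition abelian_congruence (A : finType) (n : nat)
    (w : {ffun 'I_n -> A} -> A) (r : rel A) : Prop :=
  congruence w r /\ centralizes w r r (@con0 A).

(* U is of the form g(A), with g a unary polynomial and g(beta) not
   contained in alpha. *)
Definition separating_image (A : finType) (n : nat)
    (w : {ffun 'I_n -> A} -> A) (alpha beta : rel A) (U : {set A}) : Prop :=
  exists g : A -> A,
    [/\ unary_polynomial w g,
        exists x y, beta x y /\ ~~ alpha (g x) (g y) &
        U = g @: [set: A]].

Definition minimal_set (A : finType) (n : nat) (w : {ffun 'I_n -> A} -> A)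
    (alpha beta : rel A) (U : {set A}) : Prop :=
  separating_image w alpha beta U /\
  forall V : {set A}, separating_image w alpha beta V ->
    V \subset U -> V = U.

Definition is_trace (A : finType) (n : nat) (w : {ffun 'I_n -> A} -> A)
    (alpha beta : rel A) (N : {set A}) : Prop :=
  exists U : {set A}, exists x : A,
    [/\ minimal_set w alpha beta U, x \in U, N = U :&: [set y | beta x y] &
        exists y z, [/\ y \in N, z \in N & ~~ alpha y z]].

Definition con_classes (A : finType) (r : rel A) : {set {set A}} :=
  equivalence_partition r [set: A].

Definition meet2 (x : {ffun 'I_2 -> bool}) : bool := x ord0 && x ord_max.

(* [g] is an operation of the quotient by [alpha] of the induced algebra A|_N,
   whose operations are the restrictions to N of the polynomial operations of
   A preserving N; [h] names the two elements of that quotient. These operations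
   already form a clone containing all constants. *)
Definition induced_quotient_op (A : finType) (n : nat)
    (w : {ffun 'I_n -> A} -> A) (N : {set A}) (h : A -> bool)
    (k : nat) (g : {ffun 'I_k -> bool} -> bool) : Prop :=
  exists f : {ffun 'I_k -> A} -> A,
    polynomial_op w f /\
    forall x : {ffun 'I_k -> A}, (forall i, x i \in N) ->
      f x \in N /\ h (f x) = g [ffun i => h (x i)].

(* N meets exactly the two alpha-classes C1 and C2, and (A|_N)/(alpha|_N) is
   polynomially equivalent to the meet semilattice on {C1 :&: N, C2 :&: N} with
   bottom C1 :&: N (identified with [false]). *)
Definition induces_semilattice (A : finType) (n : nat)
    (w : {ffun 'I_n -> A} -> A) (alpha : rel A) (N C1 C2 : {set A}) : Prop :=
  [/\ C1 \in con_classes alpha, C2 \in con_classes alpha & C1 != C2] /\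
  [/\ C1 :&: N != set0, C2 :&: N != set0 & N \subset C1 :|: C2] /\
  forall (k : nat) (g : {ffun 'I_k -> bool} -> bool),
    induced_quotient_op w N (fun x => x \in C2) g <-> polynomial_op meet2 g.

(* typ(alpha, beta) = 5, for alpha covered by beta: the common type of the
   minimal algebras (A|_N)/(alpha|_N), N an (alpha, beta)-trace, is that of
   the algebras polynomially equivalent to a two-element semilattice. *)
Definition type_five (A : finType) (n : nat) (w : {ffun 'I_n -> A} -> A)
    (alpha beta : rel A) : Prop :=
  forall N : {set A}, is_trace w alpha beta N ->
    exists C1 C2 : {set A}, induces_semilattice w alpha N C1 C2.

Definition class_below (A : finType) (n : nat) (w : {ffun 'I_n -> A} -> A)
    (r : rel A) (C1 C2 : {set A}) : Prop :=
  exists U : {set A},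
    minimal_set w r (@con1 A) U /\ induces_semilattice w r U C1 C2.

Definition class_le (A : finType) (n : nat) (w : {ffun 'I_n -> A} -> A)
    (r : rel A) : {set A} -> {set A} -> Prop :=
  clos_refl_trans {set A} (class_below w r).

(* Main.v *)
(* Everything takes place in A/sim.  A unary polynomial either collapses a basic
   pair (the two classes met by a minimal set) or maps it to a basic pair with
   the same orientation, so w is monotone and the order is antisymmetric.  If
   (a, c) is basic, then s(x) = w(x, c, ..., c) fixes c, satisfies x <= s(x)
   below c, and never sends a to c; iterating s, a can be enlarged until
   s(a) <= a.  For two such elements a, b below c, the wnu identities make
   w(a, b, c, ..., c) a common lower bound of a and b.  By induction on c, any
   two elements below c have a common lower bound.  Hence "having a common lower
   bound" is a congruence strictly above sim, so it is 1, and finiteness gives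
   a least class. *)
Require Import Defs.
From mathcomp Require Import all_boot boolp.
From Stdlib Require Import Operators_Properties.

Set Implicit Arguments.
Unset Strict Implicit.
Unset Printing Implicit Defensive.

(** On [U] the map [f] is a permutation, and the factorial of [#|T|] is a multiple of each of its
    cycle lengths. The exponent is written [k.+1] so that one application of [f] can be split off
    later. *)
Lemma iter_id_on (T : finType) (f : T -> T) (U : {set T}) :
  f @: U = U -> exists k, {in U, forall u, iter k.+1 f u = u}.
Proof.
move=> fU.
have f_in : {homo f : x / x \in U} by move=> x xU; rewrite -fU imset_f.
have f_inj : {in U &, injective f} by apply/imset_injP; rewrite fU.
exists (#|T|`!).-1 => u uU; rewrite prednK ?fact_gt0 //.
have /dvdnP[q ->] : order f u %| #|T|`!.
  by apply: dvdn_fact; rewrite max_card andbT; apply/card_gt0P; exists u; apply: connect0.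
by rewrite iterM iter_fix // (iter_order_in f_in).
Qed.

(** * Polynomial operations: closure properties and compatibility *)

Section Polynomials.

Variables (A : finType) (n : nat) (w : {ffun 'I_n -> A} -> A).

Fixpoint psubst (k m : nat) (s : 'I_k -> pterm A n m) (t : pterm A n k) :
    pterm A n m :=
  match t with
  | PVar i => s i
  | PCst a => PCst _ _ a
  | POp u => POp (fun i => psubst s (u i))
  end.

Lemma peval_psubst k m (s : 'I_k -> pterm A n m) t x :
  peval w (psubst s t) x = peval w t [ffun i => peval w (s i) x].
Proof.
elim: t => [i|a|u IH] //=; first by rewrite ffunE.
by congr w; apply/ffunP=> i; rewrite !ffunE IH.
Qed.

Lemma unary_polynomial_id : unary_polynomial w id.
Proof. by exists (PVar _ _ ord0). Qed.

Lemma polynomial_op_comp1 k (g : A -> A) (f : {ffun 'I_k -> A} -> A) :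
  unary_polynomial w g -> polynomial_op w f -> polynomial_op w (g \o f).
Proof.
move=> [t gE] [s fE]; exists (psubst (fun=> s) t) => x.
by rewrite peval_psubst /= fE -gE ffunE.
Qed.

Lemma polynomial_op_precomp1 k (g : A -> A) (f : {ffun 'I_k -> A} -> A) :
  unary_polynomial w g -> polynomial_op w f ->
  polynomial_op w (fun x => f [ffun i => g (x i)]).
Proof.
move=> [t gE] [s fE].
exists (psubst (fun i => psubst (fun=> PVar A n i) t) s) => x.
rewrite peval_psubst fE; congr (peval _ _ _); apply/ffunP=> i.
rewrite !ffunE peval_psubst /= -[in LHS](ffunE (fun=> x i) (ord0 : 'I_1)) gE.
by [].
Qed.

Lemma unary_polynomial_comp (g h : A -> A) :
  unary_polynomial w g -> unary_polynomial w h -> unary_polynomial w (g \o h).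
Proof. by move=> gP hP; apply: (polynomial_op_comp1 gP hP). Qed.

Lemma unary_polynomial_iter (g : A -> A) k :
  unary_polynomial w g -> unary_polynomial w (iter k g).
Proof.
move=> gP; elim: k => [|k IH]; first exact: unary_polynomial_id.
exact: (unary_polynomial_comp gP IH).
Qed.

Lemma polynomial_op_basic : polynomial_op w w.
Proof.
exists (POp (fun i => PVar A n i)) => x /=.
by congr w; apply/ffunP=> i; rewrite ffunE.
Qed.

Definition upd (z : {ffun 'I_n -> A}) (i : 'I_n) (a : A) : {ffun 'I_n -> A} :=
  [ffun l => if l == i then a else z l].

Lemma unary_polynomial_translation z i :
  unary_polynomial w (fun a => w (upd z i a)).
Proof.
exists (POp (fun l => if l == i then PVar A n ord0 else PCst n 1 (z l))) => x /=.
by congr w; apply/ffunP=> l; rewrite !ffunE; case: ifP.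
Qed.

(** Coordinates are changed one at a time: [hyb k] agrees with [y] on the first [k] coordinates and
    with [x] on the others. Symmetry of [R] is not assumed, so the lemma serves for the order as
    well as for congruences. *)
Lemma compatible_of_translations (R : A -> A -> Prop) :
  (forall a, R a a) -> (forall b a c, R a b -> R b c -> R a c) ->
  (forall z i a b, R a b -> R (w (upd z i a)) (w (upd z i b))) ->
  forall x y : {ffun 'I_n -> A}, (forall i, R (x i) (y i)) -> R (w x) (w y).
Proof.
move=> Rxx Rtr Rw x y Rxy.
pose hyb k : {ffun 'I_n -> A} := [ffun l : 'I_n => if l < k then y l else x l].
have hyb0 : hyb 0 = x by apply/ffunP=> l; rewrite ffunE.
have hybn : hyb n = y by apply/ffunP=> l; rewrite ffunE ltn_ord.
suff hybP k : k <= n -> R (w x) (w (hyb k)) by rewrite -hybn; apply: hybP.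
elim: k => [|k IH ltkn]; first by rewrite hyb0.
apply: Rtr (IH (ltnW ltkn)) _.
pose i := Ordinal ltkn.
have -> : hyb k = upd (hyb k) i (x i).
  by apply/ffunP=> l; rewrite !ffunE; case: eqP => // ->; rewrite ltnn.
have -> : hyb k.+1 = upd (hyb k) i (y i).
  apply/ffunP=> l; rewrite !ffunE ltnS leq_eqVlt -(inj_eq val_inj) /=.
  by case: eqP => // e; rewrite (_ : l = i) //; apply: val_inj.
exact: Rw.
Qed.

Lemma congruence_unary_polynomial r (g : A -> A) :
  congruence w r -> unary_polynomial w g -> forall a b, r a b -> r (g a) (g b).
Proof.
move=> [rxx _ _ rw] [t gE] a b rab.
have := gE [ffun=> a]; have := gE [ffun=> b]; rewrite !ffunE => -> -> {gE}.
elim: t => [i|c|u IH] /=; rewrite ?ffunE //.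
by apply: rw => i; rewrite !ffunE.
Qed.

Lemma con_classesP r (C : {set A}) :
  reflect (exists x, C = [set y | r x y]) (C \in con_classes r).
Proof.
apply: (iffP imsetP) => [[x _ ->]|[x ->]]; exists x => //;
  by apply/setP=> y; rewrite !inE.
Qed.

End Polynomials.

(** Projections, constants and the meet itself all commute with binary meets. This serves to rule
    out operations on a minimal set that induces a semilattice. *)
Lemma meet2_polynomial_meet k (g : {ffun 'I_k -> bool} -> bool) :
  polynomial_op meet2 g ->
  forall x y : {ffun 'I_k -> bool}, g [ffun i => x i && y i] = g x && g y.
Proof.
move=> [t gE] x y; rewrite !gE {gE}.
elim: t => [i|a|u IH] /=; first by rewrite ffunE.
  by rewrite andbb.
by rewrite /meet2 !ffunE !IH andbACA.
Qed.

Lemma meet2_polynomial_op : polynomial_op meet2 meet2.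
Proof. exact: polynomial_op_basic. Qed.

(** * Minimal sets for the covering of [sim] by the full congruence *)

Section Cover.

Variables (A : finType) (n : nat) (w : {ffun 'I_n -> A} -> A) (sim : rel A).
Hypothesis cover : con_covered w sim (@con1 A).

Notation minimal := (minimal_set w sim (@con1 A)).
Notation cls x := [set y | sim x y].

Lemma cover_congruence : congruence w sim.
Proof. by case: cover. Qed.
Let sim_cong := cover_congruence.

Lemma cover_refl : reflexive sim. Proof. by case: sim_cong. Qed.
Lemma cover_sym : symmetric sim. Proof. by case: sim_cong. Qed.
Lemma cover_trans : transitive sim. Proof. by case: sim_cong. Qed.

Lemma sim_unary g : unary_polynomial w g -> forall a b, sim a b -> sim (g a) (g b).
Proof. exact: congruence_unary_polynomial. Qed.

Lemma cls_eqP x y : reflect (cls x = cls y) (sim x y).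
Proof.
apply: (iffP idP) => [sxy|e]; last first.
  by have := cover_refl y; rewrite -[_ y y]in_set -[in X in X -> _]e inE.
apply/setP=> z; rewrite !inE; apply/idP/idP; apply: cover_trans => //.
by rewrite cover_sym.
Qed.

Lemma separating_image_of g x y : unary_polynomial w g -> ~~ sim (g x) (g y) ->
  separating_image w sim (@con1 A) (g @: [set: A]).
Proof. by move=> gP gxy; exists g; split=> //; exists x, y. Qed.

(* The pairs not separated by any polynomial with values in the image of g
   form a congruence above sim other than 1, hence equal to sim. *)
Lemma separate_into (g : A -> A) x y u v :
  unary_polynomial w g -> ~~ sim (g x) (g y) -> ~~ sim u v ->
  exists p, unary_polynomial w p /\ ~~ sim (g (p u)) (g (p v)).
Proof.
move=> gP gxy suv.
pose T a b := forall p, unary_polynomial w p -> sim (g (p a)) (g (p b)).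
have Tcong : congruence w (fun a b => `[< T a b >]).
  split.
  - by move=> a; apply/asboolP=> p _; apply: cover_refl.
  - by move=> a b; apply/asboolP/asboolP=> Tab p pP; rewrite cover_sym; apply: Tab.
  - move=> b a c /asboolP Tab /asboolP Tbc; apply/asboolP=> p pP.
    exact: cover_trans (Tab _ pP) (Tbc _ pP).
  - move=> a b Tab; apply/asboolP; apply: (compatible_of_translations (R := T)).
    + by move=> c p _; apply: cover_refl.
    + by move=> d c e Tcd Tde p pP; apply: cover_trans (Tcd _ pP) (Tde _ pP).
    + move=> z i c d Tcd p pP.
      exact: (Tcd _ (unary_polynomial_comp pP (unary_polynomial_translation w z i))).
    + by move=> i; apply/asboolP.
case: cover => _ _ _ _ /(_ _ Tcong)[].
- by move=> a b sab; apply/asboolP=> p pP; do 2!apply: sim_unary => //.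
- by [].
- move=> Ts; apply: contrapT => Nex; move/negP: suv; apply; apply: Ts.
  apply/asboolP=> p pP; apply: contrapT => Np; apply: Nex; exists p.
  by split=> //; apply/negP.
- move=> /(_ x y isT)/asboolP/(_ _ (unary_polynomial_id w)) /=.
  by rewrite (negPf gxy).
Qed.

Lemma minimal_separate U u v : minimal U -> ~~ sim u v ->
  exists q, [/\ unary_polynomial w q, forall a, q a \in U & ~~ sim (q u) (q v)].
Proof.
move=> [[g [gP [x [y [_ gxy]]] ->]] _] suv.
have [p [pP sp]] := separate_into gP gxy suv.
exists (g \o p); split=> //; first exact: unary_polynomial_comp.
by move=> a; apply: imset_f.
Qed.

(** If [U] is the image of [g], then [f @: U] is the image of [f \o g], a separating image inside
    [U], and minimality applies. *)
Lemma minimal_self_map U f x y : minimal U -> unary_polynomial w f ->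
  {in U, forall u, f u \in U} -> x \in U -> y \in U -> ~~ sim (f x) (f y) ->
  f @: U = U.
Proof.
move=> [[g [gP _ UE]] Umin] fP fU xU yU fxy.
apply: Umin; last by apply/subsetP=> _ /imsetP[u uU ->]; apply: fU.
move: xU yU fxy; rewrite {1 2}UE => /imsetP[x' _ ->] /imsetP[y' _ ->] fxy.
rewrite UE -imset_comp.
exact: (separating_image_of (unary_polynomial_comp fP gP) fxy).
Qed.

Lemma minimal_points U : minimal U -> exists x y, [/\ x \in U, y \in U & ~~ sim x y].
Proof.
move=> [[g [gP [x [y [_ gxy]]] ->]] _]; exists (g x), (g y).
by split=> //; apply: imset_f.
Qed.

(** A polynomial into [U] separating two points of [U] permutes [U], so some positive power of it is
    the identity there. *)
Lemma minimal_retraction U : minimal U ->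
  exists e, [/\ unary_polynomial w e, forall a, e a \in U &
    {in U, forall u, e u = u}].
Proof.
move=> Um; have [x [y [xU yU sxy]]] := minimal_points Um.
have [q [qP qU qxy]] := minimal_separate Um sxy.
have [k kE] := iter_id_on (minimal_self_map Um qP (fun u _ => qU u) xU yU qxy).
exists (iter k.+1 q); split=> [|a|] //; last exact: qU.
exact: unary_polynomial_iter.
Qed.

Lemma minimal_image U h x y : minimal U -> unary_polynomial w h ->
  x \in U -> y \in U -> ~~ sim (h x) (h y) ->
  minimal (h @: U) /\
  exists q, [/\ unary_polynomial w q, forall a, q a \in U &
                {in U, forall u, q (h u) = u}].
Proof.
move=> Um hP xU yU hxy.
have [q0 [q0P q0U q0xy]] := minimal_separate Um hxy.
have qhP := unary_polynomial_comp q0P hP.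
have [k kE] := iter_id_on (minimal_self_map Um qhP (fun u _ => q0U _) xU yU q0xy).
(* An inverse of [h] on [U]: [q \o h] is the power [k.+1] of [q0 \o h], which fixes [U]
   pointwise. *)
pose q := iter k (q0 \o h) \o q0.
have qP : unary_polynomial w q.
  exact: unary_polynomial_comp (unary_polynomial_iter k qhP) q0P.
have qU a : q a \in U.
  by rewrite /q /=; case: (k) => [|j] /=; apply: q0U.
have qK : {in U, forall u, q (h u) = u}.
  by move=> u uU; have := kE _ uU; rewrite iterSr.
split; last by exists q.
split.
  case: (Um) => -[g [gP _ UE]] _; move: xU yU hxy.
  rewrite UE => /imsetP[x' _ ->] /imsetP[y' _ ->] hxy; rewrite -imset_comp.
  exact: (separating_image_of (unary_polynomial_comp hP gP) hxy).
(* Minimality of [h @: U]: since [h \o q] fixes [V], the image [q @: V] still separates, hence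
   equals [U]. Then [h @: U] has at most as many elements as [U], and [U] at most as many as [V]. *)
move=> V [r [rP [a [b [_ rab]]] VE]] VhU.
have hq c : h (q (r c)) = r c.
  have /(subsetP VhU)/imsetP[u uU ->] : r c \in V by rewrite VE imset_f.
  by rewrite qK.
have qVU : q @: V = U.
  case: Um => _; apply; last by apply/subsetP=> _ /imsetP[v _ ->].
  rewrite VE -imset_comp.
  apply: (separating_image_of (unary_polynomial_comp qP rP) (x := a) (y := b)).
  by apply: contra rab => /(sim_unary hP) /=; rewrite !hq.
apply/eqP; rewrite eqEcard VhU /=.
by apply: leq_trans (leq_imset_card _ _) _; rewrite -{1}qVU leq_imset_card.
Qed.

(** * Transport of the induced semilattice between minimal sets *)

Lemma induced_quotient_op_transfer (U V : {set A}) h q (a b : A -> bool) k g :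
  unary_polynomial w h -> unary_polynomial w q ->
  {in U, forall u, h u \in V} -> {in V, forall v, q v \in U} ->
  {in U, forall u, b (h u) = a u} -> {in V, forall v, a (q v) = b v} ->
  @induced_quotient_op A n w U a k g -> @induced_quotient_op A n w V b k g.
Proof.
move=> hP qP hV qU ba ab [f [fP fU]].
exists (h \o (fun x => f [ffun i => q (x i)])); split.
  exact: polynomial_op_comp1 hP (polynomial_op_precomp1 qP fP).
move=> x xV /=.
have [|fxU fxE] := fU [ffun i => q (x i)].
  by move=> i; rewrite ffunE; apply: qU.
split; first exact: hV.
rewrite ba // fxE; congr g; apply/ffunP=> i; rewrite !ffunE; exact: ab.
Qed.

(** Conjugation by [h] and its inverse [q] carries induced operations back and forth, and [hE]
    matches the upper classes, so the orientation is kept. *)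
Lemma semilattice_image U h x y : minimal U -> unary_polynomial w h ->
  x \in U -> y \in U -> ~~ sim (h x) (h y) ->
  induces_semilattice w sim U (cls x) (cls y) ->
  minimal (h @: U) /\
  induces_semilattice w sim (h @: U) (cls (h x)) (cls (h y)).
Proof.
move=> Um hP xU yU hxy [_ [[_ _ Usub] Uop]].
have [hUm [q [qP qU qK]]] := minimal_image Um hP xU yU hxy.
split=> //.
have hE : {in U, forall u, (h u \in cls (h y)) = (u \in cls y)}.
  move=> u uU; rewrite !inE; apply/idP/idP; last exact: sim_unary.
  by move/(sim_unary qP); rewrite !qK.
split; [split|split; [split|]].
- by apply/con_classesP; exists (h x).
- by apply/con_classesP; exists (h y).
- by apply: contra hxy => /eqP/cls_eqP.
- by apply/set0Pn; exists (h x); rewrite !inE cover_refl imset_f.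
- by apply/set0Pn; exists (h y); rewrite !inE cover_refl imset_f.
- apply/subsetP=> _ /imsetP[u uU ->]; have := subsetP Usub _ uU.
  by rewrite !inE => /orP[] /(sim_unary hP) ->; rewrite ?orbT.
- move=> k g; rewrite -Uop; split; apply: induced_quotient_op_transfer.
  + exact: qP.
  + exact: hP.
  + by [].
  + by move=> u; apply: imset_f.
  + by move=> _ /imsetP[u uU ->]; rewrite qK // hE.
  + by move=> u uU; apply: hE.
  + exact: hP.
  + exact: qP.
  + by move=> u; apply: imset_f.
  + by [].
  + by move=> u uU; apply: hE.
  + by move=> _ /imsetP[u uU ->]; rewrite qK // hE.
Qed.

(** Exchanging the names of the two classes turns the meet into the join, which fails to preserve
    the meet of (1,0) and (0,1). *)
Lemma semilattice_asym U C1 C2 :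
  induces_semilattice w sim U C1 C2 -> ~ induces_semilattice w sim U C2 C1.
Proof.
move=> [[/con_classesP[x ->] /con_classesP[y ->] nxy] [[_ _ Usub] Uop]] [_ [_ Uop']].
have UC : {in U, forall u, (u \in cls x) = (u \notin cls y)}.
  move=> u /(subsetP Usub); rewrite !inE; case sxu: (sim x u); case syu: (sim y u) => //= _.
  case/negP: nxy; apply/eqP/cls_eqP; apply: cover_trans sxu _.
  by rewrite cover_sym.
have /Uop[f [fP fU]] := meet2_polynomial_op.
pose join2 (x : {ffun 'I_2 -> bool}) := x ord0 || x ord_max.
have /Uop'/meet2_polynomial_meet joinP : induced_quotient_op w U (fun z => z \in cls x) join2.
  exists f; split=> // z zU; have [fzU fzE] := fU z zU; split=> //.
  by rewrite UC // fzE /meet2 /join2 !ffunE negb_and -!UC.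
have := joinP [ffun i : 'I_2 => i == ord0] [ffun i : 'I_2 => i == ord_max].
by rewrite /join2 !ffunE.
Qed.

(** * The order on classes, written on representatives so that polynomials act on it directly *)

Definition below x y := class_below w sim (cls x) (cls y).
Definition le x y := class_le w sim (cls x) (cls y).

Lemma below_sim x y x' y' : sim x x' -> sim y y' -> below x y -> below x' y'.
Proof. by rewrite /below => /cls_eqP -> /cls_eqP ->. Qed.

Lemma belowP x y : below x y -> exists U x' y',
  [/\ minimal U, x' \in U, y' \in U, sim x x' & sim y y'] /\
  induces_semilattice w sim U (cls x') (cls y').
Proof.
move=> [U [Um Uind]]; have [_ [[/set0Pn[x' x'P] /set0Pn[y' y'P] _] _]] := Uind.
move: x'P y'P; rewrite !inE => /andP[sx x'U] /andP[sy y'U].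
exists U, x', y'; split; first by [].
by move: Uind; rewrite (cls_eqP _ _ sx) (cls_eqP _ _ sy).
Qed.

Lemma semilattice_nsim U x y :
  induces_semilattice w sim U (cls x) (cls y) -> ~~ sim x y.
Proof. by move=> [[_ _ nxy] _]; apply: contra nxy => /cls_eqP ->. Qed.

Lemma below_nsim x y : below x y -> ~~ sim x y.
Proof. by move=> [U [_ /semilattice_nsim]]. Qed.

Lemma below_unary h x y : unary_polynomial w h -> below x y ->
  sim (h x) (h y) \/ below (h x) (h y).
Proof.
move=> hP /belowP[U [x' [y' [[Um xU yU sx sy] Uind]]]].
have shx := sim_unary hP sx; have shy := sim_unary hP sy.
case hxy: (sim (h x') (h y')).
  left; apply: cover_trans shx (cover_trans hxy _); by rewrite cover_sym.
right; move/negbT in hxy.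
apply: (@below_sim (h x') (h y')); [by rewrite cover_sym..|].
by exists (h @: U); apply: semilattice_image.
Qed.

(** If [U] and [V] gave opposite orientations, the retraction onto [U] would map [V] onto [U] and
    keep the orientation of [V], so [U] would carry both. *)
Lemma below_asym x y : below x y -> ~ below y x.
Proof.
move=> /belowP[U [x1 [y1 [[Um xU yU sx sy] Uind]]]].
move=> /belowP[V [y2 [x2 [[Vm y2V x2V sy' sx'] Vind]]]].
have [e [eP eU eK]] := minimal_retraction Um.
have sx12 : sim x1 x2 by apply: cover_trans sx'; rewrite cover_sym.
have sy12 : sim y1 y2 by apply: cover_trans sy'; rewrite cover_sym.
have ex : sim x1 (e x2) by rewrite -{1}(eK _ xU); apply: sim_unary.
have ey : sim y1 (e y2) by rewrite -{1}(eK _ yU); apply: sim_unary.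
have exy : ~~ sim (e y2) (e x2).
  apply: contra (semilattice_nsim Uind) => s.
  apply: cover_trans ex _; rewrite cover_sym; exact: cover_trans ey s.
have [eVm eVind] := semilattice_image Vm eP y2V x2V exy Vind.
have eVU : e @: V = U.
  case: Um => _; apply; first by case: eVm.
  by apply/subsetP=> _ /imsetP[v _ ->].
apply: (semilattice_asym Uind).
by rewrite (cls_eqP _ _ ex) (cls_eqP _ _ ey) -{1}eVU.
Qed.

Lemma le_ind (P : A -> A -> Prop) :
  (forall x y, sim x y -> P x y) -> (forall x y, below x y -> P x y) ->
  (forall y x z, P x y -> P y z -> P x z) -> forall x y, le x y -> P x y.
Proof.
move=> Psim Pbelow Ptr.
move=> x y lexy; have {lexy} := clos_rt_rt1n _ _ _ _ lexy; move eC: (cls x) => C; move eD: (cls y) => D lexy.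
elim: lexy x eC eD => {C D}[C|C E F CE _ IH] x eC eD; last first.
  (* The closure runs over arbitrary sets; a basic step shows that its upper end is a class, hence
     has a representative [z]. *)
  case: (CE) => U [_ [[_ /con_classesP[z eE] _] _]].
  by apply: (Ptr z) (IH _ _ eD) => //; apply: Pbelow; rewrite /below eC -eE.
by apply: Psim; apply/cls_eqP; rewrite eC.
Qed.

Lemma le_sim x y : sim x y -> le x y.
Proof. by move/cls_eqP=> e; rewrite /le e; apply: rt_refl. Qed.

Lemma le_refl x : le x x. Proof. exact: rt_refl. Qed.

Lemma le_trans y x z : le x y -> le y z -> le x z.
Proof. exact: rt_trans. Qed.

Lemma below_le x y : below x y -> le x y.
Proof. by move=> xy; apply: rt_step. Qed.

Lemma le_unary h x y : unary_polynomial w h -> le x y -> le (h x) (h y).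
Proof.
move=> hP; apply: (le_ind (P := fun x y => le (h x) (h y))) => {x y}.
- by move=> x y /(sim_unary hP)/le_sim.
- by move=> x y /(below_unary hP)[/le_sim|/below_le].
- by move=> y x z; apply: le_trans.
Qed.

Lemma le_basic (x y : {ffun 'I_n -> A}) :
  (forall i, le (x i) (y i)) -> le (w x) (w y).
Proof.
apply: compatible_of_translations => [a|b a c|z i a b].
- exact: le_refl.
- exact: le_trans.
- exact: (le_unary (unary_polynomial_translation w z i)).
Qed.

(** The retraction [e] onto [U] sends [y] to the upper class. Along an ascending chain the image
    cannot drop to the lower class, since that basic step would contradict [below_asym]; so the
    chain never reaches [x]. *)
Lemma below_nle x y : below x y -> ~ le y x.
Proof.
move=> /belowP[U [x1 [y1 [[Um xU yU sx sy] Uind]]]] leyx.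
have [e [eP eU eK]] := minimal_retraction Um.
have [_ [[_ _ Usub] _]] := Uind.
suff eP' a b : le a b -> sim y1 (e a) -> sim y1 (e b).
  have {leyx} le11 : le y1 x1.
    by apply: le_trans (le_trans leyx (le_sim sx)); apply: le_sim; rewrite cover_sym.
  have := eP' _ _ le11; rewrite !eK // cover_refl => /(_ isT).
  by rewrite cover_sym (negPf (semilattice_nsim Uind)).
apply: (le_ind (P := fun a b => sim y1 (e a) -> sim y1 (e b))) => {a b}.
- by move=> a b /(sim_unary eP) sab /cover_trans; apply.
- move=> a b /(below_unary eP)[sab /cover_trans|eab ya]; first exact.
  have := subsetP Usub _ (eU b); rewrite !inE => /orP[xb|//].
  have yx : below y1 x1 by apply: below_sim eab; rewrite cover_sym.
  by case: (below_asym yx); exists U.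
- by move=> b a c; auto.
Qed.

Lemma le_nsim_below x c : le x c -> sim x c \/ exists2 a, le x a & below a c.
Proof.
apply: (le_ind (P := fun x c => sim x c \/ exists2 a, le x a & below a c)) => {x c}.
- by left.
- by move=> x y xy; right; exists x => //; apply: le_refl.
- move=> y x z [sxy|[a xa ay]] [syz|[b yb bz]].
  + by left; apply: cover_trans sxy syz.
  + by right; exists b => //; apply: le_trans yb; apply: le_sim.
  + by right; exists a => //; apply: below_sim ay; rewrite ?cover_refl.
  + right; exists b => //; apply: le_trans yb; apply: le_trans xa _.
    exact: below_le.
Qed.

(** * Consequences of the weak near-unanimity identities *)

Section WeakNearUnanimity.

Hypothesis wnu : weak_near_unanimity w.
Hypothesis type5 : type_five w sim (@con1 A).

Lemma wnu_idem x : w [ffun=> x] = x. Proof. by case: wnu. Qed.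

Definition shift c i x := w [ffun l => if l == i then x else c].

Lemma shift_unary c i : unary_polynomial w (shift c i).
Proof.
have [t tE] := unary_polynomial_translation w [ffun=> c] i.
exists t => x; rewrite -tE; congr w; apply/ffunP=> l; by rewrite !ffunE.
Qed.

Lemma shift_id c i : shift c i c = c.
Proof.
by rewrite -[RHS]wnu_idem; congr w; apply/ffunP=> l; rewrite !ffunE if_same.
Qed.

Lemma shift_ge c i x : le x c -> le x (shift c i x).
Proof.
move=> xc; rewrite -{1}[x]wnu_idem; apply: le_basic => l; rewrite !ffunE.
by case: ifP => _ //; apply: le_refl.
Qed.

(* On a minimal set with classes a < c the polynomial induced by w is a meet of
   some variables, and by the wnu identities of all of them. *)
Lemma shift_nsim a c i : below a c -> ~~ sim (shift c i a) c.
Proof.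
move=> /belowP[U [a1 [c1 [[Um aU cU sa sc] Uind]]]].
have [e [eP eU eK]] := minimal_retraction Um.
have [_ [[_ _ Usub] Uop]] := Uind; have nac := semilattice_nsim Uind.
have sim_w := let: And4 _ _ _ h := sim_cong in h.
suff ns : ~~ sim (shift c1 i a1) c1.
  apply: contra ns => s; apply: (cover_trans (y := shift c i a)).
    by apply: sim_w => l; rewrite !ffunE; case: ifP; rewrite cover_sym.
  exact: cover_trans s sc.
apply/negP => s.
pose sel (b : bool) := if b then c1 else a1.
(* The operation induced by [e \o w] on the two classes, computed on the representatives [a1] and
   [c1]. *)
pose g (b : {ffun 'I_n -> bool}) := e (w [ffun l => sel (b l)]) \in cls c1.
have UE u : u \in U -> sim u (sel (u \in cls c1)).
  move=> /(subsetP Usub); rewrite !inE /sel; case: ifP => [|_ /orP[|//]];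
    by rewrite cover_sym.
have gE : induced_quotient_op w U (fun x => x \in cls c1) g.
  exists (e \o w); split.
    exact: polynomial_op_comp1 eP (polynomial_op_basic w).
  move=> x xU; split; first exact: eU.
  rewrite /g !inE /=.
  have sw : sim (w x) (w [ffun l => sel ([ffun i0 => x i0 \in cls c1] l)]).
    by apply: sim_w => l; rewrite !ffunE; apply: UE.
  have {}sw := sim_unary eP sw.
  apply/idP/idP => h; apply: cover_trans h _ => //.
  by rewrite cover_sym.
have /meet2_polynomial_meet gM := (Uop n g).1 gE.
have g1 j : g [ffun l => l != j].
  rewrite /g inE; have -> : w [ffun l => sel ([ffun l => l != j] l)] = shift c1 i a1.
    rewrite /shift (wnu.2 c1 a1 i j); congr w.
    by apply/ffunP=> l; rewrite !ffunE /sel; case: eqP.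
  by rewrite -[X in sim X _](eK _ cU); apply: sim_unary => //; rewrite cover_sym.
(* By [g1], [g] is true when a single argument is false; preservation of meets extends this to any
   set [S] of false arguments. Taking all of them puts [a1] in the class of [c1]. *)
have gS (S : seq 'I_n) : g [ffun l => l \notin S].
  elim: S => [|j S IH].
    rewrite /g inE (_ : [ffun l => _] = [ffun=> c1]); last first.
      by apply/ffunP=> l; rewrite !ffunE.
    by rewrite wnu_idem eK // cover_refl.
  rewrite (_ : [ffun l => _] = [ffun l => [ffun l => l != j] l && [ffun l => l \notin S] l]).
    by rewrite gM g1 IH.
  by apply/ffunP=> l; rewrite !ffunE inE negb_or.
have := gS (enum 'I_n).
rewrite /g inE (_ : [ffun l => _] = [ffun=> a1]); last first.
  by apply/ffunP=> l; rewrite !ffunE mem_enum.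
by rewrite wnu_idem eK // cover_sym (negPf nac).
Qed.

Lemma below_shift_closed a c i : below a c ->
  exists a', [/\ le a a', below a' c & le (shift c i a') a'].
Proof.
move=> ac.
pose P a' := `[< le a a' /\ below a' c >].
have Pa : P a by apply/asboolP; split=> //; apply: le_refl.
(* Take a candidate with the fewest elements above it. Its shift is a candidate with a smaller or
   equal up-set, so the two up-sets coincide and [a'] lies above its shift. *)
have [a' /asboolP[aa' a'c] a'min] := arg_minnP (fun x => #|[pred y | `[< le x y >]]|) Pa.
exists a'; split=> //; set s := shift c i a'.
have a's : le a' s by apply: shift_ge; apply: below_le.
have sP : P s.
  apply/asboolP; split; first exact: le_trans a's.
  have := below_unary (shift_unary c i) a'c; rewrite shift_id => -[] //.
  by move=> h; have := shift_nsim i a'c; rewrite h.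
have sub : [pred y | `[< le s y >]] \subset [pred y | `[< le a' y >]].
  apply/subsetP=> y; rewrite !inE => /asboolP sy; apply/asboolP.
  exact: le_trans sy.
have e : #|[pred y | `[< le s y >]]| = #|[pred y | `[< le a' y >]]|.
  by apply/eqP; rewrite eqn_leq subset_leq_card // a'min.
have /(_ a') := subset_cardP e sub; rewrite !inE => sa'.
have /asboolP // : `[< le s a' >] by rewrite sa'; apply/asboolP; apply: le_refl.
Qed.

Lemma minimal_exists : exists U, minimal U.
Proof.
have [_ _ _ ns _] := cover.
have [x [y nxy]] : exists x y, ~~ sim x y.
  apply: contrapT => N; apply: ns => x y _; apply: contrapT => sxy.
  by apply: N; exists x, y; apply/negP.
pose P V := `[< separating_image w sim (@con1 A) V >].
have PT : P [set: A].
  apply/asboolP; rewrite -[setT]imset_id.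
  exact: (separating_image_of (unary_polynomial_id w) nxy).
have [U /asboolP UP Umin] := arg_minnP (fun V : {set A} => #|V|) PT.
exists U; split=> // V VP VU; apply/eqP; rewrite eqEcard VU.
by apply: Umin; apply/asboolP.
Qed.

(** The upper congruence relates everything, so the trace through any point is all of [U] and the
    type hypothesis applies to [U] itself. *)
Lemma minimal_semilattice U : minimal U ->
  exists C1 C2, induces_semilattice w sim U C1 C2.
Proof.
move=> Um; have [x [y [xU yU sxy]]] := minimal_points Um.
apply: type5; exists U, x; split=> //.
  by apply/setP=> z; rewrite !inE andbT.
by exists x, y.
Qed.

Lemma below_exists : exists x y, below x y.
Proof.
have [U Um] := minimal_exists.
have [C1 [C2 Uind]] := minimal_semilattice Um.
have [[/con_classesP[x e1] /con_classesP[y e2] _] _] := Uind.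
by exists x, y, U; rewrite -e1 -e2.
Qed.

(* With n <= 1 all polynomials are constants and projections, so none of them
   induces a meet. *)
Lemma arity_gt1 : 1 < n.
Proof.
have [a [c /belowP[U [a1 [c1 [[Um aU cU _ _] Uind]]]]]] := below_exists.
rewrite ltnNge; apply/negP => n1.
have all_eq (i j : 'I_n) : i = j.
  apply: val_inj; have := leq_trans (ltn_ord i) n1; have := leq_trans (ltn_ord j) n1.
  by rewrite !ltnS !leqn0 /= => /eqP -> /eqP ->.
have polyE k (f : {ffun 'I_k -> A} -> A) : polynomial_op w f ->
    (exists c, forall x, f x = c) \/ (exists i, forall x, f x = x i).
  move=> [t fE]; elim: t f fE => [i|b|u IH] f fE; first by right; exists i.
    by left; exists b.
  have [i _|N] := pickP 'I_n.
    apply: (IH i) => x; rewrite fE -[RHS]wnu_idem /=; congr w.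
    by apply/ffunP=> l; rewrite !ffunE (all_eq l i).
  left; exists (w [ffun=> a]) => x.
  by rewrite fE /=; congr w; apply/ffunP=> l; have := N l.
have [_ [_ Uop]] := Uind.
have nca : (a1 \in cls c1) = false.
  by rewrite inE cover_sym (negPf (semilattice_nsim Uind)).
have cc : c1 \in cls c1 by rewrite inE cover_refl.
have /Uop[f [fP fU]] := meet2_polynomial_op.
have fE (b : 'I_2 -> bool) :
    (f [ffun i => if b i then c1 else a1] \in cls c1) = b ord0 && b ord_max.
  have [|_ ->] := fU [ffun i => if b i then c1 else a1].
    by move=> i; rewrite ffunE; case: ifP.
  by rewrite /meet2 !ffunE; do 2![case: (b _)]; rewrite ?cc ?nca.
case: (polyE _ _ fP) => [[d fd]|[j fj]].
  by have := fE xpred0; have := fE xpredT; rewrite !fd => ->.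
(* A projection to coordinate [j] is true at the indicator of [j], where the meet is false because
   the other coordinate is. *)
have := fE (pred1 j); rewrite fj ffunE /= eqxx cc.
by case: eqP => // <-.
Qed.

(** * Common lower bounds and the least class *)

Lemma lower_bound_of_common_upper c x y : le x c -> le y c ->
  exists2 z, le z x & le z y.
Proof.
pose i0 := Ordinal (ltnW arity_gt1); pose i1 := Ordinal arity_gt1.
(* Induction on the number of elements below [c]. It drops on passing to [a] with [below a c],
   because [c] itself is lost. *)
have [k] := ubnP #|[pred z | `[< le z c >]]|.
elim: k c x y => // k IH c x y; rewrite ltnS => ck xc yc.
have IH' a : below a c -> forall x y, le x a -> le y a -> exists2 z, le z x & le z y.
  move=> ac x' y'; apply: IH; apply: leq_trans ck; apply: proper_card.
  apply/properP; split.
    apply/subsetP=> z; rewrite !inE => /asboolP za; apply/asboolP.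
    exact: le_trans za (below_le ac).
  exists c; rewrite !inE; first by apply/asboolP; apply: le_refl.
  by apply/asboolP; apply: below_nle.
case: (le_nsim_below xc) => [sxc|[a0 xa0 a0c]].
  exists y; last exact: le_refl.
  by apply: le_trans yc _; apply: le_sim; rewrite cover_sym.
case: (le_nsim_below yc) => [syc|[b0 yb0 b0c]].
  exists x; first exact: le_refl.
  by apply: le_trans xc _; apply: le_sim; rewrite cover_sym.
have [a [a0a ac sa]] := below_shift_closed i0 a0c.
have [b [b0b bc sb]] := below_shift_closed i1 b0c.
(* Raising [b] to [c] bounds [z] by [shift c i0 a], hence by [a]; raising [a] to [c] bounds it by
   [shift c i1 b], hence by [b]. *)
pose z := w [ffun l => if l == i0 then a else if l == i1 then b else c].
have za : le z a.
  apply: le_trans sa; apply: le_basic => l; rewrite !ffunE.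
  case: ifP => _; first exact: le_refl.
  by case: ifP => _; [apply: below_le|apply: le_refl].
have zb : le z b.
  apply: le_trans sb; apply: le_basic => l; rewrite !ffunE.
  case: eqP => [->|_]; first exact: below_le.
  by case: ifP => _; apply: le_refl.
(* Both [x] and [z] lie below [a], which gives [u]; then [u] and [y] lie below [b], since [u] is
   below [z]. *)
have [u ux uz] := IH' _ ac _ _ (le_trans xa0 a0a) za.
have [v vu vy] := IH' _ bc _ _ (le_trans uz zb) (le_trans yb0 b0b).
by exists v => //; apply: le_trans ux.
Qed.

(* Having a common lower bound is a congruence strictly above sim. *)
Lemma lower_bound x y : exists2 z, le z x & le z y.
Proof.
pose T a b := `[< exists2 z, le z a & le z b >].
have Tcong : congruence w T.
  split.
  - by move=> a; apply/asboolP; exists a; apply: le_refl.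
  - by move=> a b; apply/asboolP/asboolP=> -[z]; exists z.
  - move=> b a c /asboolP[u ua ub] /asboolP[v vb vc]; apply/asboolP.
    have [z zu zv] := lower_bound_of_common_upper ub vb.
    by exists z; [apply: le_trans ua|apply: le_trans vc].
  - move=> a b Tab; apply/asboolP.
    (* Lower bounds are chosen coordinatewise; by monotonicity [w] maps them to a common lower
       bound. *)
    have [|f fP] := choice (P := fun i z => le z (a i) /\ le z (b i)) (X := 'I_n).
      by move=> i; have /asboolP[z] := Tab i; exists z.
    by exists (w [ffun i => f i]); apply: le_basic => i; rewrite ffunE; case: (fP i).
case: cover => _ _ _ _ /(_ _ Tcong)[].
- by move=> a b /le_sim ab; apply/asboolP; exists a => //; apply: le_refl.
- by [].
- move=> Tsim; have [a [b ab]] := below_exists.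
  have := below_nsim ab; rewrite Tsim //; apply/asboolP.
  by exists a; [apply: le_refl|apply: below_le].
- by move=> /(_ x y isT)/asboolP.
Qed.

Lemma least_class : exists C0 : {set A}, C0 \in con_classes sim /\
  forall C : {set A}, C \in con_classes sim -> class_le w sim C0 C.
Proof.
have [a0 _] := below_exists.
(* Pairwise lower bounds are accumulated along the enumeration of [A], with the arbitrary start
   [a0]. *)
have [m mP] : exists m, forall x, x \in enum A -> le m x.
  elim: (enum A) => [|x s [m mP]]; first by exists a0.
  have [z zm zx] := lower_bound m x; exists z => y; rewrite inE => /predU1P[->//|ys].
  exact: le_trans zm (mP _ ys).
exists (cls m); split; first by apply/con_classesP; exists m.
by move=> _ /con_classesP[x ->]; apply: mP; rewrite mem_enum.
Qed.

End WeakNearUnanimity.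

End Cover.

Theorem theorem3p7 (A : finType) (n : nat) (w : {ffun 'I_n -> A} -> A)
    (sim : rel A) :
  weak_near_unanimity w ->
  abelian_congruence w sim ->
  con_covered w sim (@con1 A) ->
  type_five w sim (@con1 A) ->
  exists C0 : {set A}, C0 \in con_classes sim /\
    forall C : {set A}, C \in con_classes sim -> class_le w sim C0 C.
Proof. by move=> wnu _ cover type5; apply: least_class. Qed.
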